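(* Let $G$ be a well-founded win or lose game on a game tree $(V,E)$ with set of leaves $Z$. Then $$\mathit{SPE}(G)=\{s\in S\mid \forall w\in V\setminus Z\ \exists i\in\{1,2\}\ [\,s^w\in \mathit{win}_i(G^w)\times S^w_{-i}\,]\}.$$
   Context: A two-player extensive game with perfect information is $G=(T,\mathit{turn},p_1,p_2)$, where $T=(V,E)$ is a (possibly infinite) rooted tree with edges directed away from the root and set of leaves $Z$, $\mathit{turn}:V\setminus Z\to\{1,2\}$ says who moves at each non-leaf node, and $p_i:Z\to\mathbb{R}$ is the payoff function of player $i$. The game is well-founded if $T$ has no infinite paths. The opponent of player $i$ is denoted $-i$. A strategy of player $i$ is a function $s_i$ assigning to each non-leaf node $u$ with $\mathit{turn}(u)=i$ a child of $u$; $S_i$ is the set of these strategies, and $S=S_1\times S_2$ is the set of joint strategies. In a well-founded game, following a joint strategy $s$ from the root leads to a unique leaf, denoted $\mathit{leaf}(s)$. A joint strategy $s$ is a Nash equilibrium if for all players $i$ and all $s'_i\in S_i$, $p_i(\mathit{leaf}(s_i,s_{-i}))\ge p_i(\mathit{leaf}(s'_i,s_{-i}))$. For a node $w$, the subgame $G^w$ has the same players, the subtree $T^w$ of $T$ rooted at $w$, and the restrictions of $\mathit{turn}$ and the payoff functions to $T^w$; $S_i^w$ is the set of strategies of player $i$ in $G^w$, and $s^w$ is the restriction of $s$ to $G^w$. A joint strategy $s$ is a subgame perfect equilibrium of $G$ if for every node $w$ of $T$, $s^w$ is a Nash equilibrium in $G^w$. $\mathit{SPE}(G)$ is the set of subgame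 perfect equilibria of $G$. $G$ is a win or lose game if the only possible outcomes (values of $(p_1,p_2)$ at leaves) are $(1,-1)$ and $(-1,1)$. A strategy $s_i\in S_i$ is a winning strategy of player $i$ if for all $s_{-i}\in S_{-i}$, $p_i(\mathit{leaf}(s_i,s_{-i}))=1$. $\mathit{win}_i(G)$ is the (possibly empty) set of winning strategies of player $i$ in $G$. In a product such as $\mathit{win}_i(G^w)\times S^w_{-i}$ the first factor is the component of player $i$ and the second that of player $-i$; it is regarded as a set of joint strategies. *)

(* Defs.v *)
From mathcomp Require Import all_boot all_order all_algebra.
From mathcomp Require Import boolp classical_sets reals.

Set Implicit Arguments.
Unset Strict Implicit.
Unset Printing Implicit Defensive.

Import Order.TTheory GRing.Theory Num.Theory.

Local Open Scope classical_set_scope.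
Local Open Scope ring_scope.

(* [dpath E u p v]: the edges of E lead from u to v, where p lists the nodes
   visited after u, so that the path with no edge is [::]. *)
Fixpoint dpath (V : Type) (E : V -> V -> Prop) (u : V) (p : seq V) (v : V)
    : Prop :=
  if p is x :: p' then E u x /\ dpath E x p' v else u = v.

Definition rooted_tree (V : Type) (E : V -> V -> Prop) (r : V) : Prop :=
  forall v, exists! p, dpath E r p v.

Definition leaves (V : Type) (E : V -> V -> Prop) : set V :=
  [set u | forall v, ~ E u v].

Variant player := player1 | player2.

Definition opponent (i : player) : player :=
  if i is player1 then player2 else player1.

Record game (R : realType) := Game {
  node : Type;
  edge : node -> node -> Prop;
  root_node : node;
  edge_tree : rooted_tree edge root_node;
  turn : {u | (~` leaves edge) u} -> player;
  payoff : player -> {z | leaves edge z} -> R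
}.

Arguments edge {R} G : rename.
Arguments root_node {R} G : rename.
Arguments edge_tree {R} G : rename.
Arguments turn {R} G : rename.
Arguments payoff {R} G : rename.

Section Play.
Variables (R : realType) (G : game R).

Definition decision_node : Type := {u | (~` leaves (edge G)) u}.
Definition leaf_node : Type := {z | leaves (edge G) z}.

Definition well_founded_game : Prop :=
  ~ exists f : nat -> node G, forall n, edge G (f n) (f n.+1).

Definition win_or_lose : Prop := forall z : leaf_node,
  (payoff G player1 z, payoff G player2 z) = (1, -1) \/
  (payoff G player1 z, payoff G player2 z) = (-1, 1).

Definition strategy (i : player) : Type :=
  forall u : decision_node, turn G u = i -> {v | edge G (sval u) v}.

Definition joint_strategy : Type := forall i : player, strategy i.

(* (s_i, s_{-i}), for either value of i. *)
Definition pair_strategy (i : player) :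
    strategy i -> strategy (opponent i) -> joint_strategy :=
  match i with
  | player1 => fun si so j =>
      match j with player1 => si | player2 => so end
  | player2 => fun si so j =>
      match j with player1 => so | player2 => si end
  end.

Definition move (s : joint_strategy) (u : decision_node) : node G :=
  sval (s (turn G u) u erefl).

Inductive play (s : joint_strategy) : node G -> Prop :=
| play_root : play s (root_node G)
| play_move (u : decision_node) : play s (sval u) -> play s (move s u).

Lemma play_leaf (wfG : well_founded_game) (s : joint_strategy) :
  exists! z : leaf_node, play s (sval z).
Proof.
pose step (u : node G) : node G :=
  match pselect (leaves (edge G) u) with
  | left _ => u
  | right nu => move s (exist (~` leaves (edge G)) u nu)
  end.
have step_leaf u : leaves (edge G) u -> step u = u.
  by rewrite /step; case: pselect.
have step_edge u : ~ leaves (edge G) u -> edge G u (step u).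
  by rewrite /step; case: pselect => // nu _; apply: proj2_sig.
have play_step u : play s u -> play s (step u).
  rewrite /step; case: pselect => // nu pu.
  exact: (@play_move s (exist (~` leaves (edge G)) u nu)).
have play_iter u : play s u -> exists n, u = iter n step (root_node G).
  elim=> [|[{}u nu] _ [n /= un]]; first by exists 0%N.
  exists n.+1; rewrite iterS -un /step; case: pselect => // nu'.
  by congr (move s (exist _ _ _)); apply: Prop_irrelevance.
have iter_play n : play s (iter n step (root_node G)).
  by elim: n => [|n IH]; [exact: play_root | exact: play_step].
have iter_leaf n m : leaves (edge G) (iter n step (root_node G)) ->
    (n <= m)%N -> iter m step (root_node G) = iter n step (root_node G).
  move=> lf /subnK <-; elim: (m - n)%N => // k IH.
  by rewrite addSn iterS IH step_leaf.
have [n ln] : exists n, leaves (edge G) (iter n step (root_node G)).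
  apply: contrapT => nl; apply: wfG; exists (fun n => iter n step (root_node G)) => n.
  by apply: step_edge => ln; apply: nl; exists n.
exists (exist (leaves (edge G)) _ ln); split=> [|[z lz] /= /play_iter[m zm]].
  exact: iter_play.
have e : iter n step (root_node G) = z.
  rewrite zm; rewrite zm in lz.
  by have [/iter_leaf|/ltnW/iter_leaf] := leqP n m => ->.
by move: lz; rewrite -e => lz; congr exist; apply: Prop_irrelevance.
Qed.

Definition leaf (wfG : well_founded_game) (s : joint_strategy) : leaf_node :=
  sval (cid (play_leaf wfG s)).

Definition nash_equilibrium (wfG : well_founded_game) (s : joint_strategy)
    : Prop :=
  forall (i : player) (si' : strategy i),
    payoff G i (leaf wfG (pair_strategy si' (s (opponent i))))
    <= payoff G i (leaf wfG (pair_strategy (s i) (s (opponent i)))).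

Definition win (wfG : well_founded_game) (i : player) : set (strategy i) :=
  [set si | forall so : strategy (opponent i),
    payoff G i (leaf wfG (pair_strategy si so)) = 1].

(* A_i x B_{-i}, as a set of joint strategies. *)
Definition joint_setX (i : player)
    (A : set (strategy i)) (B : set (strategy (opponent i)))
    : set joint_strategy :=
  [set s | A (s i) /\ B (s (opponent i))].

End Play.

Arguments win {R G} wfG i.
Arguments leaf {R G} wfG s.
Arguments nash_equilibrium {R G} wfG s.

Section Subgame.
Variables (R : realType) (G : game R) (w : node G).

Definition sub_node : Type := {v | exists p, dpath (edge G) w p v}.

Definition sub_edge (u v : sub_node) : Prop := edge G (sval u) (sval v).

Lemma sub_node_inj (u v : sub_node) : sval u = sval v -> u = v.
Proof.
case: u v => [u hu] [v hv] /= e; move: hv; rewrite -e => hv.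
by congr exist; apply: Prop_irrelevance.
Qed.

Definition sub_root : sub_node :=
  exist (fun v => exists p, dpath (edge G) w p v) w
    (ex_intro (fun p => dpath (edge G) w p w) [::] erefl).

Lemma dpath_cat (V : Type) (E : V -> V -> Prop) (p q : seq V) (a b c : V) :
  dpath E a p b -> dpath E b q c -> dpath E a (p ++ q) c.
Proof. by elim: p a => [|x p IH] a /= => [->|[? ?] ?] //; split=> //; apply: IH. Qed.

Lemma sub_child (u : sub_node) (v : node G) :
  edge G (sval u) v -> exists p, dpath (edge G) w p v.
Proof.
by case: u => u [p wu] /= uv; exists (p ++ [:: v]); apply: dpath_cat wu _.
Qed.

Definition sub_succ (u : sub_node) (v : node G) (uv : edge G (sval u) v) :
    sub_node :=
  exist (fun v => exists p, dpath (edge G) w p v) v (sub_child uv).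

Lemma dpath_sub_node (p : seq (node G)) (u : sub_node) (v : node G) :
  dpath (edge G) (sval u) p v ->
  exists q (v' : sub_node), [/\ sval v' = v, map sval q = p & dpath sub_edge u q v'].
Proof.
elim: p u => [|x p IH] u /= => [<-|[ux xv]]; first by exists [::], u.
have [q [v' [<- <- xv']]] := IH (sub_succ ux) xv.
by exists (sub_succ ux :: q), v'.
Qed.

Lemma dpath_sval (p : seq sub_node) (u v : sub_node) :
  dpath sub_edge u p v -> dpath (edge G) (sval u) (map sval p) (sval v).
Proof. by elim: p u => [|x p IH] u /= => [->|[? /IH]]. Qed.

Lemma sub_edge_tree : rooted_tree sub_edge sub_root.
Proof.
move=> v; have [p wv] := proj2_sig v.
have [q [v' [/sub_node_inj -> _ wq]]] := @dpath_sub_node p sub_root _ wv.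
exists q; split=> // q' wq'.
have [r [wr _]] := edge_tree G w; have [t [_ uniq_t]] := edge_tree G (sval v).
have := etrans (esym (uniq_t _ (dpath_cat wr (dpath_sval wq))))
                (uniq_t _ (dpath_cat wr (dpath_sval wq'))).
move=> /(congr1 (drop (size r))); rewrite !drop_size_cat //.
exact/inj_map/sub_node_inj.
Qed.

Lemma sub_leaves (u : sub_node) :
  leaves sub_edge u -> leaves (edge G) (sval u).
Proof. by move=> lu v uv; apply: (lu (sub_succ uv)). Qed.

Lemma sub_nonleaves (u : sub_node) :
  (~` leaves sub_edge) u -> (~` leaves (edge G)) (sval u).
Proof. by move=> nu lu; apply: nu => v; apply: lu. Qed.

Definition lift_decision (u : {u | (~` leaves sub_edge) u}) :
    decision_node G :=
  exist (~` leaves (edge G)) (sval (sval u)) (sub_nonleaves (proj2_sig u)).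

Definition lift_leaf (z : {z | leaves sub_edge z}) : leaf_node G :=
  exist (leaves (edge G)) (sval (sval z)) (sub_leaves (proj2_sig z)).

Definition subgame : game R :=
  @Game R sub_node sub_edge sub_root sub_edge_tree
    (fun u => turn G (lift_decision u))
    (fun i z => payoff G i (lift_leaf z)).

Lemma subgame_wf : well_founded_game G -> well_founded_game subgame.
Proof. by move=> wfG [f fE]; apply: wfG; exists (fun n => sval (f n)). Qed.

Definition restrict (s : joint_strategy G) : joint_strategy subgame :=
  fun i u tu => let v := s i (lift_decision u) tu in
    exist (sub_edge (sval u)) (@sub_succ (sval u) (sval v) (proj2_sig v))
      (proj2_sig v).

End Subgame.

Arguments subgame {R} G w.
Arguments subgame_wf {R G} w wfG.
Arguments restrict {R G} w s.

Definition SPE (R : realType) (G : game R) (wfG : well_founded_game G) :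
    set (joint_strategy G) :=
  [set s | forall w : node G,
    nash_equilibrium (subgame_wf w wfG) (restrict w s)].

Arguments SPE {R G} wfG.

(* Main.v *)
Require Import Defs.
From mathcomp Require Import all_boot all_order all_algebra.
From mathcomp Require Import boolp classical_sets reals.

(* In a win or lose game a joint strategy is a Nash equilibrium iff one of its
   two components is winning: the player who loses under an equilibrium loses
   against the same opponent strategy whatever they play.  Applied to each
   subgame this gives the equality node by node, without backward induction;
   the subgames rooted at a leaf are trivial, having a single play. *)

Import Order.TTheory GRing.Theory Num.Theory.

Local Open Scope ring_scope.
Local Open Scope classical_set_scope.

Section NashWin.
Context {R : realType} {G : game R}.

Lemma pair_strategy_eta (s : joint_strategy G) (i : player) :
  pair_strategy (s i) (s (opponent i)) = s.
Proof. by apply: functional_extensionality_dep; case: i => -[]. Qed.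

Lemma win_or_lose_payoff (wlG : win_or_lose G) (i : player) (z : leaf_node G) :
  payoff G i z = 1 \/ payoff G i z = -1.
Proof. by case: (wlG z) => -[e1 e2]; case: i; auto. Qed.

(** The game is zero-sum, which turns an upper bound for one player into a lower bound for the
    other. *)
Lemma win_or_lose_opp (wlG : win_or_lose G) (i : player) (z : leaf_node G) :
  payoff G (opponent i) z = - payoff G i z.
Proof. by case: (wlG z) => -[e1 e2]; case: i; rewrite /= e1 e2 ?opprK. Qed.

Lemma win_or_lose_le1 (wlG : win_or_lose G) (i : player) (z : leaf_node G) :
  payoff G i z <= 1.
Proof. by case: (win_or_lose_payoff wlG i z) => -> //; rewrite (le_trans (lerN10 _)). Qed.

Context (wfG : well_founded_game G).

(** Puts a deviation of the opponent in the form used by [win]. [opponent (opponent i)] reduces to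
    [i] only once [i] is a constructor, hence the case split. *)
Lemma nash_equilibrium_opp (s : joint_strategy G) (i : player)
    (so : strategy G (opponent i)) :
  nash_equilibrium wfG s ->
  payoff G (opponent i) (leaf wfG (pair_strategy (s i) so))
  <= payoff G (opponent i) (leaf wfG s).
Proof.
move=> /(_ (opponent i) so); rewrite pair_strategy_eta.
by case: i so.
Qed.

Lemma nash_equilibrium_win (wlG : win_or_lose G) (s : joint_strategy G) :
  nash_equilibrium wfG s -> exists i, win wfG i (s i).
Proof.
move=> nash_s.
have [i si1] : exists i, payoff G i (leaf wfG s) = 1.
  have [|sN1] := win_or_lose_payoff wlG player1 (leaf wfG s); first by exists player1.
  by exists player2; rewrite (win_or_lose_opp wlG player1) sN1 opprK.
exists i => so; apply/le_anti; rewrite win_or_lose_le1 //=.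
(* Under [s] the opponent gets -1 and cannot improve on it, so player [i] gets at least 1 against
   [so]. *)
by have := nash_equilibrium_opp s i so nash_s; rewrite !win_or_lose_opp // lerN2 si1.
Qed.

(** The winner already has the maximal payoff 1, and any deviation of the opponent still meets a
    winning strategy and yields -1. *)
Lemma win_nash_equilibrium (wlG : win_or_lose G) (s : joint_strategy G)
    (i : player) :
  win wfG i (s i) -> nash_equilibrium wfG s.
Proof.
move=> win_i j; rewrite pair_strategy_eta.
have si1 : payoff G i (leaf wfG s) = 1.
  by rewrite -[s in leaf _ s](pair_strategy_eta s i).
have [ -> | -> ] : j = i \/ j = opponent i by case: (i) (j) => -[]; auto.
  by move=> si'; rewrite si1 win_or_lose_le1.
move=> so; rewrite win_or_lose_opp // win_or_lose_opp // si1.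
suff -> : pair_strategy so (s (opponent (opponent i))) = pair_strategy (s i) so.
  by rewrite win_i.
by case: (i) so.
Qed.

Lemma leaf_root (s : joint_strategy G) :
  leaves (edge G) (root_node G) -> sval (leaf wfG s) = root_node G.
Proof.
move=> lr; rewrite /leaf; case: cid => z [/= pz _].
(* By induction a move could only start at the root, which is a leaf. *)
by elim: pz => // -[u nu] _ /= ur; case: nu; rewrite ur.
Qed.

Lemma nash_equilibrium_leaf (s : joint_strategy G) :
  leaves (edge G) (root_node G) -> nash_equilibrium wfG s.
Proof.
move=> lr i si'; set s' := pair_strategy si' _; rewrite pair_strategy_eta.
suff -> : leaf wfG s' = leaf wfG s by [].
have := leaf_root s' lr; rewrite -(leaf_root s lr).
case: (leaf _ s') (leaf _ s) => [z lz] [z' lz'] /= e.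
by case: _ / e lz' => lz'; congr exist; apply: Prop_irrelevance.
Qed.

End NashWin.

Lemma win_or_lose_subgame (R : realType) (G : game R) (w : node G) :
  win_or_lose G -> win_or_lose (subgame G w).
Proof. by move=> wlG z; apply: wlG. Qed.

Theorem corollary16 (R : realType) (G : game R) (wfG : well_founded_game G)
    (wlG : win_or_lose G) :
  SPE wfG =
  [set s : joint_strategy G |
    forall w : node G, (~` leaves (edge G)) w ->
    exists i : player,
      joint_setX (win (subgame_wf w wfG) i) setT (restrict w s)].
Proof.
apply/seteqP; split=> s /= sP w.
  move=> _; have [i win_i] := nash_equilibrium_win _ (win_or_lose_subgame _ _ w wlG) _ (sP w).
  by exists i.
(* [sP] speaks only of non-leaves; at a leaf [w] the root of the subgame is itself a leaf, so no
   deviation changes the outcome. *)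
have [lw|/sP[i [win_i _]]] := pselect (leaves (edge G) w).
  by apply: nash_equilibrium_leaf => v; apply: lw.
exact: win_nash_equilibrium (win_or_lose_subgame _ _ w wlG) _ _ win_i.
Qed.
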